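(* Let $\mu=\prod_{n=1}^{\infty}\nu_n$ be a centered probability measure on $[0,1]^{\mathbb{N}}$ (in the sense defined in the context). Then $\mu(\mathcal{C}_I)=0$; that is, for $\mu$-almost every sequence $(p_i)_{i=1}^\infty$ the Condorcet Jury Property fails.
   Context: For a sequence $(p_i)_{i=1}^\infty\in[0,1]^{\mathbb{N}}$ let $X_1,X_2,\dots$ be independent random variables with values in $\{0,1\}$ and $\mathbb{P}(X_i=1)=p_i$. The sequence satisfies the Condorcet Jury Property (CJP) if $\lim_{n\to\infty,\ n\text{ odd}}\mathbb{P}\left(\sum_{i=1}^n X_i>\frac n2\right)=1$. $\mathcal{C}_I\subset[0,1]^{\mathbb{N}}$ denotes the set of sequences satisfying the CJP. All measures are Borel probability measures; $\nu\ll\nu'$ denotes absolute continuity. Hellinger integral: for probability measures $\nu,\nu'$ on $[0,1]$, $H(\nu,\nu')=\int_{[0,1]}\sqrt{\frac{d\nu}{d\tau}\frac{d\nu'}{d\tau}}\,d\tau$ for any measure $\tau$ with $\nu,\nu'\ll\tau$. Class $\mathcal{D}$: a function $d$ on pairs of probability measures on $[0,1]$ which is either a divergence ($d(\nu,\nu')\ge 0$ with equality iff $\nu=\nu'$) or a distance (a metric) belongs to $\mathcal{D}$ if there is a constant $C>0$ with $1-H(\nu,\nu')\le C\, d(\nu,\nu')$ for all $\nu,\nu'$. (E.g. total variation distance and Kullback–Leibler divergence belong to $\mathcal{D}$.) Centered measure: a product probability measure $\mu=\prod_{n=1}^\infty\nu_n$ on $[0,1]^{\mathbb{N}}$ is centered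 if there is a probability measure $\nu_0$ on $[0,1]$ such that $\nu_n\ll\nu_0$ for all $n\ge1$, $\int_{[0,1]}x\,d\nu_0(x)=\frac12$, and $\sum_{n=1}^\infty d(\nu_n,\nu_0)<\infty$ for some $d\in\mathcal{D}$. *)

(* Defs.v *)
From HB Require Import structures.
From mathcomp Require Import all_boot all_order all_algebra.
From mathcomp Require Import all_classical all_reals all_analysis.
Set Implicit Arguments. Unset Strict Implicit. Unset Printing Implicit Defensive.
Import Order.TTheory GRing.Theory Num.Theory.
Import numFieldNormedType.Exports.
Local Open Scope classical_set_scope.
Local Open Scope ring_scope.

(* A probability measure on [0,1] is represented as a Borel probability
   measure on R that is concentrated on [0,1]. *)
Definition onI (R : realType) (nu : probability R R) : Prop :=
  nu [set x : R | 0 <= x <= 1] = 1%E.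

Definition meas_eq (R : realType) (nu nu' : probability R R) : Prop :=
  forall A : set R, measurable A -> nu A = nu' A.

Definition is_density (R : realType) (tau : {measure set R -> \bar R})
  (nu : probability R R) (f : R -> R) : Prop :=
  [/\ measurable_fun setT f, (forall x, 0 <= f x) &
      forall A : set R, measurable A -> nu A = (\int[tau]_(x in A) (f x)%:E)%E].

(* Hellinger integral: H(nu,nu') = int sqrt(dnu/dtau * dnu'/dtau) dtau,
   for any measure tau dominating both (the value is independent of tau). *)
Definition hellinger_is (R : realType) (nu nu' : probability R R) (h : \bar R) : Prop :=
  exists (tau : {measure set R -> \bar R}) (f f' : R -> R),
    [/\ is_density tau nu f, is_density tau nu' f' &
        h = (\int[tau]_x (Num.sqrt (f x * f' x))%:E)%E].

Definition is_divergence (R : realType)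
  (d : probability R R -> probability R R -> \bar R) : Prop :=
  forall nu nu', onI nu -> onI nu' ->
    (0 <= d nu nu')%E /\ (d nu nu' = 0%E <-> meas_eq nu nu').

Definition is_distance (R : realType)
  (d : probability R R -> probability R R -> \bar R) : Prop :=
  (forall nu nu', onI nu -> onI nu' ->
     [/\ d nu nu' \is a fin_num, (0 <= d nu nu')%E,
         (d nu nu' = 0%E <-> meas_eq nu nu') & d nu nu' = d nu' nu]) /\
  (forall nu nu' nu'', onI nu -> onI nu' -> onI nu'' ->
     (d nu nu'' <= d nu nu' + d nu' nu'')%E).

Definition classD (R : realType)
  (d : probability R R -> probability R R -> \bar R) : Prop :=
  (is_divergence d \/ is_distance d) /\
  exists C : R, 0 < C /\
    forall nu nu' (h : \bar R), onI nu -> onI nu' -> hellinger_is nu nu' h ->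
      (1 - h <= C%:E * d nu nu')%E.

Definition cyl_gen (R : realType) : set (set (nat -> R)) :=
  [set B | exists (i : nat) (A : set R), measurable A /\
                                        B = (fun p : nat -> R => p i) @^-1` A].

Arguments cyl_gen R : clear implicits.
Definition Seq (R : realType) := g_sigma_algebraType (cyl_gen R).

(* mu is the product measure prod_n nu_n: its value on every measurable
   finite-dimensional rectangle is the product of the marginals
   (this determines mu uniquely). Index n = 0 corresponds to nu_1. *)
Definition is_product_measure (R : realType) (mu : probability (Seq R) R)
  (nu : nat -> probability R R) : Prop :=
  forall (n : nat) (A : nat -> set R), (forall i, measurable (A i)) ->
    mu [set p : Seq R | forall i, (i < n)%N -> A i (p i)] =
    (\prod_(i < n) nu i (A i))%E.

Definition centered (R : realType) (nu : nat -> probability R R) : Prop :=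
  exists nu0 : probability R R,
    [/\ onI nu0, (forall n, nu n `<< nu0),
        (\int[nu0]_x (x%:E) = (2^-1 : R)%:E)%E &
        exists d, classD d /\ (\sum_(0 <= n <oo) d (nu n) nu0 < +oo)%E].

(* P(sum_{i<n} X_i > n/2) for independent X_i ~ Bernoulli(p_i) *)
Definition majority_prob (R : realType) (p : nat -> R) (n : nat) : R :=
  \sum_(S : {set 'I_n} | (n < 2 * #|S|)%N)
     \prod_(i < n) (if i \in S then p i else 1 - p i).

Definition CJP (R : realType) (p : nat -> R) : Prop :=
  (fun k : nat => majority_prob p k.*2.+1) @ \oo --> (1 : R).

Definition C_I (R : realType) : set (nat -> R) :=
  [set p | (forall i, 0 <= p i <= 1) /\ CJP p].
Arguments C_I R : clear implicits.

(* Main.v *)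
Require Import Defs.
From HB Require Import structures.
From mathcomp Require Import all_boot all_order all_algebra.
From mathcomp Require Import ring lra zify.
From mathcomp Require Import all_classical all_reals all_analysis measurable_realfun.
Set Implicit Arguments. Unset Strict Implicit. Unset Printing Implicit Defensive.
Import Order.TTheory GRing.Theory Num.Theory.
Import numFieldNormedType.Exports.
Local Open Scope classical_set_scope.
Local Open Scope ring_scope.

(* Averaging over the biases, the votes become independent coins with biases
   [q_i], the mean of [nu_i], and AM-GM bounds [(2 q_i - 1)^2] by
   [8 (1 - H(nu_i, nu0))], so these squares are summable.  If the CJP held with
   positive probability, then for some [N] the set [A] of sequences whose majority
   probability is at least [24/25] from [N] on would have positive measure.  [A] is a
   decreasing limit of sets [B_M] depending on the first [2 M] biases only.  Given
   such a [B_M], the majority of a far larger number [n] of votes is, up to [2 M]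
   votes, decided by nearly fair coins independent of [B_M], hence is correct with
   conditional probability at most [23/25].  So [24/25 mu A <= 23/25 mu B_M] for all
   large [M], and letting [M] tend to infinity gives [mu A = 0]. *)

(** * Tail probabilities of a sum of independent coins *)

Section tail.
Variable R : realType.
Implicit Types (p q : nat -> R) (n j k l m : nat).

(* The probability that at least [j] of [n] independent coins with biases
   [p 0, ..., p (n - 1)] show heads, computed by conditioning on the last coin. *)
Fixpoint tail p n j : R :=
  match j, n with
  | 0, _ => 1
  | _.+1, 0 => 0
  | j'.+1, n'.+1 => p n' * tail p n' j' + (1 - p n') * tail p n' j
  end.

Lemma tail0 p n : tail p n 0 = 1. Proof. by case: n. Qed.

Lemma tailS p n j :
  tail p n.+1 j.+1 = p n * tail p n j + (1 - p n) * tail p n j.+1.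
Proof. by []. Qed.

Lemma eq_tail p q n j : (forall i, (i < n)%N -> p i = q i) -> tail p n j = tail q n j.
Proof.
elim: n j => [[]//|n IH] [//|j] pq; rewrite !tailS pq// !IH// => i /ltnW;
  exact: pq.
Qed.

Lemma tail_ge0_le1 p n j : (forall i, 0 <= p i <= 1) -> 0 <= tail p n j <= 1.
Proof.
move=> p01; elim: n j => [[|j]|n IH [|j]]/=; rewrite ?ler01 ?lexx//.
have /andP[a0 a1] := IH j; have /andP[b0 b1] := IH j.+1.
have /andP[c0 c1] := p01 n; apply/andP; split; nra.
Qed.

Lemma tail_gt p n j : (n < j)%N -> tail p n j = 0.
Proof.
elim: n j => [[]//|n IH [//|j]]; rewrite ltnS => nj.
by rewrite tailS !IH ?mulr0 ?addr0// ltnS ltnW.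
Qed.

(** The product is the probability generating function of the number of heads. Expanding it by
    distributivity, a set [S] of heads contributes its probability times ['X^#|S|]. *)
Lemma coef_prod_linear p n k :
  (\prod_(i < n) ((p i)%:P * 'X + (1 - p i)%:P))`_k =
  \sum_(S : {set 'I_n} | #|S| == k) \prod_(i < n) (if i \in S then p i else 1 - p i).
Proof.
rewrite bigA_distr/= coef_sum [RHS]big_mkcond/=; apply: eq_bigr => S _.
have -> : \prod_(i < n) (if i \in S then (p i)%:P * 'X else (1 - p i)%:P) =
    (\prod_(i < n) (if i \in S then p i else 1 - p i))%:P * 'X^#|S| :> {poly R}.
  rewrite rmorph_prod/= -(prodr_const (mem S) 'X).
  rewrite [X in _ * X]big_mkcond -big_split/=; apply: eq_bigr => i _.
  by case: ifP => // _; rewrite mulr1.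
by rewrite coefCM coefXn eq_sym; case: eqP; rewrite ?mulr1 ?mulr0.
Qed.

(** Multiplying the generating function by the factor of the last coin shifts and mixes its
    coefficients exactly as the recursion of [tail] does. *)
Lemma tailE p n j :
  tail p n j = 1 - \sum_(k < j) (\prod_(i < n) ((p i)%:P * 'X + (1 - p i)%:P))`_k.
Proof.
elim: n j => [[|j]|n IH [|j]]; rewrite ?tail0 ?big_ord0 ?subr0//.
  rewrite big_ord_recl/= coef1/= big1 ?addr0 ?subrr// => i _.
  by rewrite coef1.
rewrite tailS !IH.
under [in RHS]eq_bigr do rewrite big_ord_recr/= mulrDr coefD mulrA coefMX !coefMC.
rewrite [in RHS]big_split/= -[in RHS]mulr_suml [X in _ - (X + _)]big_ord_recl/= add0r.
rewrite -mulr_suml; ring.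
Qed.

(** Links the recursion to the sum over subsets that defines [majority_prob]: the probabilities of
    all subsets add up to 1, and the subsets of size [k < j] make up the coefficients subtracted in
    [tailE]. *)
Lemma sum_card_ge p n j :
  \sum_(S : {set 'I_n} | (j <= #|S|)%N)
     \prod_(i < n) (if i \in S then p i else 1 - p i) = tail p n j.
Proof.
rewrite tailE.
have : \sum_(S : {set 'I_n}) \prod_(i < n) (if i \in S then p i else 1 - p i) = 1.
  transitivity (\prod_(i < n) (p i + (1 - p i))); first by rewrite bigA_distr.
  by rewrite big1// => i _; rewrite addrC subrK.
rewrite (bigID (fun S : {set 'I_n} => j <= #|S|)%N)/= => /(canRL (addrK _)) ->.
congr (1 - _); under [RHS]eq_bigr do rewrite coef_prod_linear big_mkcond/=.
rewrite exchange_big/= big_mkcond/=; apply: eq_bigr => S _.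
rewrite -ltnNge -big_mkcond/=; case: ltnP => Sj.
  by rewrite (big_pred1 (Ordinal Sj))//= => i; rewrite eq_sym.
by rewrite big_pred0// => i; apply/eqP => E; have := ltn_ord i; rewrite -E ltnNge Sj.
Qed.

Lemma majority_probE p k : majority_prob p k.*2.+1 = tail p k.*2.+1 k.+1.
Proof.
rewrite -sum_card_ge; apply: eq_bigl => S.
by apply/idP/idP; lia.
Qed.

(* Cauchy-Schwarz against the fair coin: [1 + (2 q - 1)^2] is the second moment
   of the likelihood ratio of a [q]-coin with respect to a fair one. *)
Lemma tail_fair q n j :
  tail q n j ^+ 2 <= tail (fun=> 2^-1) n j * \prod_(i < n) (1 + (2 * q i - 1) ^+ 2).
Proof.
have pr n' : 1 <= \prod_(i < n') (1 + (2 * q i - 1) ^+ 2).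
  elim: n' => [|n' IH]; first by rewrite big_ord0.
  rewrite big_ord_recr/= -[leLHS]mulr1; apply: ler_pM => //.
  by rewrite lerDl sqr_ge0.
elim: n j => [|n IH] [|j].
- by rewrite !tail0 big_ord0 expr1n mulr1.
- by rewrite /= expr0n mul0r.
- by rewrite !tail0 expr1n mul1r pr.
rewrite !tailS big_ord_recr/=; have := IH j; have := IH j.+1.
move: (\prod_(i < n) _) (tail q n j) (tail q n j.+1) (tail (fun=> 2^-1) n j)
  (tail (fun=> 2^-1) n j.+1).
move=> P a b v w; set x := q n => bw av.
have -> : 2^-1 * v + (1 - 2^-1) * w = (v + w) / 2 by field.
have x0 : 0 <= 1 + (2 * x - 1) ^+ 2 by rewrite addr_ge0// sqr_ge0.
(* Cauchy-Schwarz in the plane, as [x^2 + (1 - x)^2 = (1 + (2 x - 1)^2) / 2]; the defect is the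
   square [((1 - x) a - x b)^2]. *)
apply: (@le_trans _ _ ((1 + (2 * x - 1) ^+ 2) / 2 * (a ^+ 2 + b ^+ 2))).
  by have := sqr_ge0 ((1 - x) * a - x * b); nra.
have -> : (v + w) / 2 * (P * (1 + (2 * x - 1) ^+ 2)) =
  (1 + (2 * x - 1) ^+ 2) / 2 * (v * P + w * P) by field.
by rewrite ler_wpM2l ?divr_ge0// lerD.
Qed.

(** Replaces the exponential bound on the product: each new factor satisfies
    [(1 + x) (1 - s - x) <= 1 - s] for nonnegative [x] and [s]. *)
Lemma prod_1D_le (a : nat -> R) n : (forall i, 0 <= a i) ->
  (\prod_(i < n) (1 + a i)) * (1 - \sum_(i < n) a i) <= 1.
Proof.
move=> a0; elim: n => [|n IH]; first by rewrite !big_ord0 subr0 mulr1.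
rewrite !big_ord_recr/=; apply: le_trans IH.
have : 0 <= \prod_(i < n) (1 + a i) by apply: prodr_ge0 => i _; rewrite addr_ge0.
have : 0 <= \sum_(i < n) a i by apply: sumr_ge0.
move: (\prod_(i < n) _) (\sum_(i < n) _) (a0 n) => P s; move: (a n) => x x0 s0 P0.
rewrite -mulrA ler_wpM2l//; nra.
Qed.

(** * Fair coins: the median and the size of point probabilities *)

Local Notation fair := (tail (fun=> 2^-1)).

Lemma fair_diff l j : fair l j - fair l j.+1 = 'C(l, j)%:R / 2 ^+ l.
Proof.
elim: l j => [[|j]|l IH [|j]].
- by rewrite /= bin0 subr0 expr0 divr1.
- by rewrite /= bin0n subr0 mul0r.
- rewrite tailS tail0 bin0 exprS.
  have := IH 0; rewrite tail0 bin0 => /(canRL (subrK _)) h.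
  by have -> : tail (fun=> 2^-1) l 1 = 1 - 1%:R / 2 ^+ l; [lra|field; rewrite expf_neq0].
rewrite !tailS binS natrD exprS.
have : (('C(l, j.+1)%:R + 'C(l, j)%:R) / (2 * 2 ^+ l) : R) =
  2^-1 * ('C(l, j.+1)%:R / 2 ^+ l) + 2^-1 * ('C(l, j)%:R / 2 ^+ l).
  by field; rewrite expf_neq0.
by move=> ->; rewrite -!IH; field.
Qed.

(** Exchanging heads and tails turns the complementary event, fewer than [j] heads, into at least
    [l + 1 - j] heads. *)
Lemma fair_sym l j : (j <= l.+1)%N -> fair l j + fair l (l.+1 - j) = 1.
Proof.
elim: l j => [[|[|]]//|l IH [|j]].
- by rewrite addr0.
- by rewrite add0r.
- by move=> _; rewrite tail0 subn0 tail_gt// addr0.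
rewrite ltnS leq_eqVlt => /predU1P[->|jl].
  by rewrite subnn tail0 tail_gt// add0r.
have -> : (l.+2 - j.+1)%N = (l - j).+1 by lia.
rewrite !tailS.
have := IH j (ltnW jl); have := IH j.+1 jl.
by rewrite subSS subSn//; lra.
Qed.

(** The left side is 1 at [n = 0] and does not increase: consecutive values have ratio
    [(2n + 1)(2n + 3) / (2n + 2)^2 <= 1]. *)
Lemma central_bin n : ('C(n.*2, n)%:R / 4 ^+ n) ^+ 2 * (n.*2.+1)%:R <= 1 :> R.
Proof.
elim: n => [|n IH]; first by rewrite bin0 expr0 divr1 expr1n mulr1.
have E : (n.+1 * 'C(n.+1.*2, n.+1) = 2 * n.*2.+1 * 'C(n.*2, n))%N.
  have h1 := mul_bin_diag n.*2.+2 n; have h2 := mul_bin_diag n.*2.+1 n.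
  have h3 : 'C(n.*2.+1, n) = 'C(n.*2.+1, n.+1).
    by rewrite -(@bin_sub n.*2.+1 n.+1) ?ltnS -?addnn ?leq_addr// subSS addnK.
  rewrite /= in h1 h2; apply/eqP; rewrite -(eqn_pmul2l (ltn0Sn n)) doubleS; apply/eqP.
  rewrite -h1 h3 mulnA [(n.+1 * _.*2.+2)%N]mulnC -mulnA -h2; nia.
have -> : 'C(n.+1.*2, n.+1)%:R = 2 * (n.*2.+1)%:R / n.+1%:R * 'C(n.*2, n)%:R :> R.
  have ER : n.+1%:R * 'C(n.+1.*2, n.+1)%:R = 2 * (n.*2.+1)%:R * 'C(n.*2, n)%:R :> R.
    by rewrite -!natrM E.
  by rewrite -mulrAC -ER mulrC mulKf// pnatr_eq0.
apply: le_trans IH.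
move: 'C(n.*2, n) => c; rewrite (exprS 4).
have n0 : n.+1%:R != 0 :> R by rewrite pnatr_eq0.
have -> : (2 * n.*2.+1%:R / n.+1%:R * c%:R / (4 * 4 ^+ n)) ^+ 2 * (n.+1.*2.+1)%:R =
 ((c%:R / 4 ^+ n) ^+ 2 * (n.*2.+1)%:R) *
   ((n.*2.+1)%:R * (n.+1.*2.+1)%:R / (2 * n.+1%:R) ^+ 2) :> R.
  by field; rewrite nat1r n0 expf_neq0.
rewrite ler_piMr ?mulr_ge0 ?sqr_ge0//.
rewrite ler_pdivrMr ?exprn_gt0 ?mulr_gt0 ?ltr0n// mul1r -!natrM -natrX ler_nat; nia.
Qed.

(** By symmetry of binomials, the square is one term of Vandermonde's sum for the right side. *)
Lemma bin_sqr_le l k : ('C(l, k) ^ 2 <= 'C(l.*2, l))%N.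
Proof.
have [kl|lk] := leqP k l; last by rewrite bin_small.
rewrite -addnn -binomial.Vandermonde; rewrite (bigD1 (Ordinal (kl : (k < l.+1)%N)))//=.
by rewrite (bin_sub kl) mulnn leq_addr.
Qed.

(** Passing to ['C(l.*2, l)] gives a bound uniform in [j] and indifferent to the parity of [l]. The
    resulting order [l^(-1/4)] is not sharp, but any rate tending to 0 suffices. *)
Lemma fair_diff_le l j : (fair l j - fair l j.+1) ^+ 4 * (l.*2.+1)%:R <= 1.
Proof.
rewrite fair_diff; apply: le_trans (central_bin l).
rewrite ler_wpM2r// (exprM _ 2 2) ler_pXn2r ?nnegrE ?divr_ge0 ?exprn_ge0//.
rewrite expr_div_n -exprM mulnC exprM (_ : 2 ^+ 2 = 4)%R; last by ring.
by rewrite ler_wpM2r ?invr_ge0 ?exprn_ge0// -natrX ler_nat bin_sqr_le.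
Qed.

(** With [l] and [j] the two arguments of the tail, the thresholds [j] and [j + m] are mirror
    images, so their tails add up to 1. The tails differ by [m] point probabilities, each at most
    [1 / (2 m)] for large [k], hence by at most 1/2. *)
Lemma fair_le_near m : exists k0, forall k, (k0 <= k)%N ->
  fair (k.*2.+1 - m) (k.+1 - m) <= 3 / 4.
Proof.
(* This makes [l] at least [(2 m)^4], so that [fair_diff_le] bounds point probabilities by
   [1 / (2 m)]. *)
exists (m + (2 * m) ^ 4)%N => k kk; set l := (_ - m)%N; set j := (_ - m)%N.
have mk : (m <= k)%N by apply: leq_trans kk; exact: leq_addr.
have d_le i : 2 * m%:R * (fair l i - fair l i.+1) <= 1.
  have [d0|/ltW d0] := leP (fair l i - fair l i.+1) 0.
    by rewrite (le_trans _ ler01)// mulr_ge0_le0.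
  have m0 : 0 <= 2 * m%:R * (fair l i - fair l i.+1) by rewrite mulr_ge0.
  rewrite -(@ler_pXn2r _ 4)// ?nnegrE// expr1n; apply: le_trans (fair_diff_le l i).
  rewrite exprMn mulrC ler_wpM2l ?exprn_ge0// -natrM -natrX ler_nat /l.
  by move: kk; move: ((2 * m) ^ 4)%N; lia.
have D i : 2 * m%:R * (fair l j - fair l (j + i)) <= i%:R.
  elim: i => [|i IH]; first by rewrite addn0 subrr mulr0.
  rewrite addnS -natr1; have := d_le (j + i)%N; lra.
have := @fair_sym l j; have -> : (l.+1 - j = j + m)%N by lia.
move=> /(_ ltac:(lia)); have := D m.
have [->|m0] := posnP m; first by rewrite addn0; lra.
have := ltr0n R m; rewrite m0; set M := m%:R; nra.
Qed.
End tail.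

(** * Truncation of real numbers to biases *)

Section clamp.
Variable R : realType.

(* [mu] is a measure on all real sequences; clamping makes every sequence a
   sequence of biases and changes nothing on [[0, 1]]. *)
Definition clamp (x : R) : R := Order.min (Order.max x 0) 1.

Lemma clamp_ge0 x : 0 <= clamp x.
Proof. by rewrite /clamp le_min ler01 le_max lexx orbT. Qed.

Lemma clamp_le1 x : clamp x <= 1.
Proof. by rewrite /clamp ge_min lexx orbT. Qed.

Lemma clamp_id x : 0 <= x <= 1 -> clamp x = x.
Proof. by move=> /andP[x0 x1]; rewrite /clamp max_l// min_l. Qed.

Lemma clamp_tail_bounds (p : nat -> R) n j :
  0 <= tail (fun i => clamp (p i)) n j <= 1.
Proof. by apply: tail_ge0_le1 => i; rewrite clamp_ge0 clamp_le1. Qed.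

Lemma measurable_clamp : measurable_fun setT clamp.
Proof. by apply: measurable_minr => //; apply: measurable_maxr. Qed.
End clamp.

(** * Deviation of the mean from 1/2 against the Hellinger integral *)

Section hellinger.
Variable R : realType.
Variables (nu nu0 : probability R R).
Hypothesis (nudom : nu `<< nu0).

(** The Radon-Nikodym derivative chosen here is finite everywhere, so [fine] makes it real-valued
    without changing any integral. *)
Lemma density_exists : exists f : R -> R, is_density nu0 nu f /\
  (forall g : R -> \bar R, (forall x, 0 <= g x)%E -> measurable_fun setT g ->
    (\int[nu0]_x (g x * (f x)%:E) = \int[nu]_x g x)%E).
Proof.
pose F := Radon_Nikodym_SigmaFinite.f nu nu0.
have FE x : (fine (F x))%:E = F x.
  by rewrite fineK//; exact: Radon_Nikodym_SigmaFinite.f_fin_num.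
exists (fine \o F); split; last first.
  move=> g g0 mg; rewrite -(Radon_Nikodym_SigmaFinite.change_of_variables nudom)//.
  by apply: eq_integral => x _; rewrite /= FE.
split.
- apply: measurableT_comp => //.
  exact: measurable_int (Radon_Nikodym_SigmaFinite.f_integrable nudom).
- by move=> x; apply: fine_ge0; exact: Radon_Nikodym_SigmaFinite.f_ge0.
- move=> A mA; rewrite (Radon_Nikodym_SigmaFinite.f_integral nudom)//.
  by apply: eq_integral => x _; rewrite /= FE.
Qed.

(* With [s = sqrt f] and [d = 2 q - 1], [d^2] is the [nu0]-integral of
   [d (2 clamp x - 1) (s - 1) (s + 1)], and AM-GM bounds this integrand by
   [d^2 (s + 1)^2 / 8 + 2 (s - 1)^2]. *)
Lemma mean_sqr_le_hellinger (q : R) :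
  (\int[nu0]_x (clamp x)%:E = (2^-1)%:E)%E -> (\int[nu]_x (clamp x)%:E = q%:E)%E ->
  exists2 h : R, hellinger_is nu nu0 h%:E & (2 * q - 1) ^+ 2 <= 8 * (1 - h).
Proof.
move=> mean0 meanq.
have [f [[mf f0 fE] changeV]] := density_exists.
have If : nu0.-integrable setT (EFin \o f).
  apply/integrableP; split; first exact/measurable_EFinP.
  under eq_integral do rewrite /= ger0_norm//.
  by rewrite -fE// probability_setT ltry.
have I1 : nu0.-integrable setT (EFin \o cst 1).
  exact: (finite_measure_integrable_cst nu0 1).
(* The functions integrated below are all combinations of ones dominated by the integrable
   [1 + f]. *)
have int0 (g : R -> R) : measurable_fun setT g -> (forall x, `|g x| <= 1 + f x) ->
    nu0.-integrable setT (EFin \o g).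
  move=> mg gle; apply: le_integrable (integrableD measurableT I1 If) => //.
    exact/measurable_EFinP.
  by move=> x _ /=; rewrite lee_fin (le_trans (gle x))// ler_norm.
pose s (x : R) : R := Num.sqrt (f x).
have sE x : s x ^+ 2 = f x by rewrite sqr_sqrtr.
have s0 x : 0 <= s x by exact: sqrtr_ge0.
have ms : measurable_fun setT s.
  apply: (measurableT_comp (f := @Num.sqrt R)) => //.
  by apply: continuous_measurable_fun; exact: sqrt_continuous.
have mc := @measurable_clamp R.
have Is : nu0.-integrable setT (EFin \o s).
  apply: int0 => // x; rewrite ger0_norm// -sE.
  by have := sqr_ge0 (s x - 1); nra.
have Ic : nu0.-integrable setT (EFin \o @clamp R).
  apply: int0 => // x; rewrite ger0_norm ?clamp_ge0//.
  by rewrite (le_trans (clamp_le1 x))// lerDl.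
have Icf : nu0.-integrable setT (EFin \o (fun x => clamp x * f x)).
  apply: int0 => [|x]; first exact: measurable_funM.
  have c0 := clamp_ge0 x; have c1 := clamp_le1 x; have fx := f0 x.
  by rewrite ger0_norm ?mulr_ge0//; nra.
pose h := \int[nu0]_x s x.
have hE : (\int[nu0]_x (s x)%:E = h%:E)%E.
  by rewrite /h /Rintegral fineK//; exact: integrable_fin_num Is.
have fI : \int[nu0]_x f x = 1 by rewrite /Rintegral -fE// probability_setT.
have cI : \int[nu0]_x clamp x = 2^-1 by rewrite /Rintegral mean0.
have cfI : \int[nu0]_x (clamp x * f x) = q.
  rewrite /Rintegral -[RHS]/(fine q%:E) -meanq -changeV//.
    by move=> x; rewrite lee_fin clamp_ge0.
  exact/measurable_EFinP.
have lin a1 a2 a3 a4 a5 :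
    \int[nu0]_x (a1 * f x + a2 * s x + a3 * (clamp x * f x) + a4 * clamp x + a5) =
    a1 + a2 * h + a3 * q + a4 / 2 + a5.
  have Z a g : nu0.-integrable setT (EFin \o g) ->
      nu0.-integrable setT (EFin \o (fun x => a * g x)) by exact: integrableZl.
  have D g1 g2 : nu0.-integrable setT (EFin \o g1) -> nu0.-integrable setT (EFin \o g2) ->
      nu0.-integrable setT (EFin \o (fun x => g1 x + g2 x)) by exact: integrableD.
  have J1 := D _ _ (Z a1 _ If) (Z a2 _ Is).
  have J2 := D _ _ J1 (Z a3 _ Icf).
  have J3 := D _ _ J2 (Z a4 _ Ic).
  have J4 : nu0.-integrable setT (EFin \o cst a5).
    exact: (finite_measure_integrable_cst nu0 a5).
  rewrite (RintegralD measurableT J3 J4) (RintegralD measurableT J2 (Z a4 _ Ic)).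
  rewrite (RintegralD measurableT J1 (Z a3 _ Icf)).
  rewrite (RintegralD measurableT (Z a1 _ If) (Z a2 _ Is)).
  rewrite !RintegralZl// fI cfI cI mulr1 Rintegral_cst//.
  congr (_ + _); rewrite -[RHS]mulr1; congr (_ * _).
  exact: (congr1 fine (probability_setT nu0)).
exists h.
  exists nu0, f, (cst 1); split => //.
    by split=> // A mA; rewrite (integral_cst nu0 mA 1) mul1e.
  by rewrite -hE; apply: eq_integral => x _; rewrite mulr1.
(* Integrating [(s - 1)^2] gives [h <= 1], which absorbs the term [d^2 h / 4] at the end. *)
have h1 : 0 <= 1 + (-2) * h + 0 * q + 0 / 2 + 1.
  rewrite -lin; apply: Rintegral_ge0 => x _; rewrite -sE.
  by have := sqr_ge0 (s x - 1); nra.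
pose d := 2 * q - 1.
have : 0 <= (d ^+ 2 / 8 + 2 + d) + (d ^+ 2 / 4 - 4) * h + (- 2 * d) * q +
    (2 * d) / 2 + (d ^+ 2 / 8 + 2 - d).
  rewrite -lin; apply: Rintegral_ge0 => x _; rewrite -sE.
  have c0 := clamp_ge0 x; have c1 := clamp_le1 x.
  set u := s x; set c := clamp x in c0 c1 *.
  (* The first square is the gap in AM-GM; the second term is what is lost by bounding
     [(1 - 2 c)^2 = 1 - 4 c (1 - c)] by 1. *)
  have -> : (d ^+ 2 / 8 + 2 + d) * u ^+ 2 + (d ^+ 2 / 4 - 4) * u + - 2 * d * (c * u ^+ 2) +
    2 * d * c + (d ^+ 2 / 8 + 2 - d) =
    (d * (u + 1) * (1 - 2 * c) + 4 * (u - 1)) ^+ 2 / 8 +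
     (d * (u + 1)) ^+ 2 / 8 * (4 * c * (1 - c)) by field.
  by rewrite addr_ge0// mulr_ge0// ?sqr_ge0// ?divr_ge0 ?sqr_ge0// ?mulr_ge0// subr_ge0.
by rewrite -/d; have -> : q = (d + 1) / 2 by [rewrite /d; field]; have := sqr_ge0 d; nra.
Qed.
End hellinger.

(** * Independence of a coordinate from the preceding ones *)

Section independence.
Variable R : realType.

Definition rectangle (n : nat) : set (set (nat -> R)) :=
  [set B | exists2 A : nat -> set R, (forall i, measurable (A i)) &
    B = [set p | forall i, (i < n)%N -> A i (p i)]].

(* [nat -> R], but measurable sets depend on the first [n] coordinates only *)
Definition Prefix n := g_sigma_algebraType (rectangle n).

Lemma rectangle_setI n : setI_closed (rectangle n).
Proof.
move=> _ _ [A mA ->] [B mB ->]; exists (fun i => A i `&` B i).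
  by move=> i; exact: measurableI.
apply/seteqP; split => p /=; first by move=> [pA pB] i ni; split; [exact: pA|exact: pB].
by move=> pAB; split => i ni; have [] := pAB i ni.
Qed.

Lemma measurable_coord i :
  measurable_fun setT (fun p : Seq R => p i).
Proof.
move=> _ A mA; rewrite setTI; apply: sub_sigma_algebra.
by exists i, A.
Qed.

Lemma measurable_prefix_coord n i : (i < n)%N ->
  measurable_fun setT (fun p : Prefix n => p i).
Proof.
move=> ni _ A mA; rewrite setTI; apply: sub_sigma_algebra.
exists (fun j => if j == i then A else setT); first by move=> j; case: ifP.
apply/seteqP; split => p /=; first by move=> Ap j _; case: ifP => // /eqP->.
by move=> /(_ i ni); rewrite eqxx.
Qed.

Lemma measurable_rectangle n (A : nat -> set R) : (forall i, measurable (A i)) ->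
  measurable ([set p | forall i, (i < n)%N -> A i (p i)] : set (Seq R)).
Proof.
move=> mA.
rewrite (_ : [set p | _] = \bigcap_(i in [set i | (i < n)%N])
    ((fun p : Seq R => p i) @^-1` A i)).
  apply: bigcap_measurableType => i _.
  by rewrite -[X in measurable X]setTI; exact: measurable_coord.
by apply/seteqP; split => p /= h i ni; exact: h.
Qed.

Lemma measurable_prefix n : measurable_fun setT (fun p : Seq R => p : Prefix n).
Proof.
apply: (@measurability _ _ (Seq R) (Prefix n) _ _ (rectangle n)) => //=.
move=> _ [_ [A mA ->] <-].
by rewrite setTI; exact: measurable_rectangle.
Qed.

Variables (nu : nat -> probability R R) (mu : probability (Seq R) R).
Hypothesis munu : is_product_measure mu nu.

(** On rectangles this is the product formula for [n] and [n + 1] coordinates. Rectangles are stable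
    under intersection and the identity passes to complements and disjoint unions, so Dynkin's
    theorem extends it. *)
Lemma prefix_indep n (A : set (Prefix n)) (B : set R) : measurable A -> measurable B ->
  (mu ((A : set (Seq R)) `&` [set p | B (p n)]) = mu A * nu n B)%E.
Proof.
move=> mA mB; move: A mA; pose C := [set p : Seq R | B (p n)].
have mC : measurable C.
  by rewrite -[X in measurable X]setTI; exact: (@measurable_coord n measurableT B mB).
have mS (D : set (Prefix n)) : measurable D -> measurable (D : set (Seq R)).
  by move=> mD; have := measurable_prefix measurableT mD; rewrite setTI.
have muC : mu C = nu n B.
  have := munu n.+1 (A := fun i => if i == n then B else setT).
  rewrite big_ord_recr/= eqxx big1 ?mul1e => [<-|i _]; last first.
  - by rewrite ltn_eqF// probability_setT.
  - by move=> i; case: ifP.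
  congr (mu _); apply/seteqP; split => p /=; first by move=> Bp i _; case: eqP => // ->.
  by move=> /(_ n (ltnSn n)); rewrite eqxx.
apply: (@dynkin_induction _ (Prefix n) (rectangle n)
   [set A | mu ((A : set (Seq R)) `&` C) = mu A * nu n B]%E) => //.
- exact: rectangle_setI.
- by rewrite /= setTI probability_setT mul1e.
- move=> _ [A mA ->] /=; rewrite (munu n)//.
  have := munu n.+1 (A := fun i => if i == n then B else A i).
  rewrite big_ord_recr/= eqxx.
  under eq_bigr do rewrite ltn_eqF//.
  move=> <-; last by move=> i; case: ifP.
  congr (mu _); apply/seteqP; split => p /=.
    by move=> [pA pB] i; rewrite ltnS leq_eqVlt; case: eqP => [->//|/= _ /pA].
  move=> h; split => [i ni|]; last by have := h n (ltnSn n); rewrite eqxx.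
  by have := h i (ltnW ni); rewrite ltn_eqF.
- move=> A mA /= AE.
  have -> : (~` A) `&` C = C `\` (A : set (Seq R)) by rewrite setDE setIC.
  rewrite measureD ?ltey_eq ?fin_num_measure//; [|exact: mS..].
  rewrite probability_setC; last exact: mS.
  rewrite muleBl ?fin_num_adde_defl ?fin_num_measure//.
    rewrite mul1e; congr (_ - _)%E; first exact: muC.
    by rewrite -AE; congr (mu _); exact: setIC.
  by rewrite fin_numN fin_num_measure//; exact: mS.
- move=> F mF tF FE /=; rewrite setI_bigcupl !measure_bigcup//; last 3 first.
  + by move=> i _; exact: mS.
  + by move=> i _; apply: measurableI => //; exact: mS.
  + exact: trivIset_setIr.
  rewrite muleC -[nu n B]fineK ?fin_num_measure// -nneseriesZl//.
  apply: eq_eseriesr => i _; rewrite fineK ?fin_num_measure// muleC.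
  exact: FE.
Qed.

(** By [prefix_indep] and uniqueness of product measures, the joint law of the prefix and the next
    coordinate is a product; Tonelli then separates the integrals. *)
Lemma integral_prefix_coord n (G : Prefix n -> \bar R) (g : R -> \bar R) :
  measurable_fun setT G -> measurable_fun setT g ->
  (forall p, 0 <= G p)%E -> (forall x, 0 <= g x)%E ->
  (\int[mu]_p (G p * g (p n)) = \int[mu]_p G p * \int[nu n]_x g x)%E.
Proof.
move=> mG mg G0 g0.
have mphi : measurable_fun setT (fun p : Seq R => (p : Prefix n, p n)).
  by apply: measurable_fun_pair; [exact: measurable_prefix|exact: measurable_coord].
have mf : measurable_fun setT (fun z : Prefix n * R => G z.1 * g z.2)%E.
  apply: emeasurable_funM; first exact: (measurableT_comp mG measurable_fst).
  exact: (measurableT_comp mg measurable_snd).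
pose X : {mfun Seq R >-> (Prefix n * R)%type} :=
  HB.pack (fun p : Seq R => (p : Prefix n, p n)) (isMeasurableFun.Build _ _ _ _ _ mphi).
pose Y : {mfun Seq R >-> Prefix n} := HB.pack (fun p : Seq R => (p : Prefix n))
  (isMeasurableFun.Build _ _ _ _ _ (@measurable_prefix n)).
pose P : probability (Prefix n * R)%type R := distribution mu X.
pose Q : probability (Prefix n) R := distribution mu Y.
transitivity (\int[P]_z (G z.1 * g z.2))%E.
  by rewrite ge0_integral_distribution// => z; exact: mule_ge0.
have PQ : forall X, measurable X -> (Q \x nu n)%E X = P X.
  apply: product_measure_unique => A B mA mB.
  exact: prefix_indep.
rewrite (eq_measure_integral (Q \x nu n)%E); last by move=> A mA _; exact/esym/PQ.
rewrite fubini_tonelli1//=; last by move=> z; exact: mule_ge0.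
rewrite /fubini_F/=.
under eq_integral do rewrite ge0_integralZl//.
rewrite ge0_integralZr//; last exact: integral_ge0.
by rewrite ge0_integral_distribution.
Qed.
End independence.

Lemma measurable_tail (R : realType) (d : measure_display) (T : measurableType d)
    (X : nat -> T -> R) n j :
  (forall i, (i < n)%N -> measurable_fun setT (X i)) ->
  measurable_fun setT (fun t => tail (X ^~ t) n j).
Proof.
elim: n j => [[|j]|n IH [|j]] mX //=.
have mX' i : (i < n)%N -> measurable_fun setT (X i) by move=> /ltnW /mX.
have mXn := mX n (ltnSn n).
apply: measurable_funD; apply: measurable_funM => //; try exact: IH.
exact: measurable_funB.
Qed.

(** * Averaging over the random biases *)

Section annealed.
Variable R : realType.
Variables (nu : nat -> probability R R) (mu : probability (Seq R) R).
Hypothesis munu : is_product_measure mu nu.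

(** A coin whose bias is drawn from [nu] is, on average, a coin with this bias. *)
Definition mean (nu : probability R R) : R := fine (\int[nu]_x (clamp x)%:E)%E.

Lemma integral_clamp_ge0_le1 (P : probability R R) :
  (0 <= \int[P]_x (clamp x)%:E <= 1)%E.
Proof.
apply/andP; split; first by apply: integral_ge0 => x _; rewrite lee_fin clamp_ge0.
have <- : (\int[P]_x (cst 1%:E x) = 1)%E.
  by rewrite integral_cst// mul1e; exact: (probability_setT P).
apply: ge0_le_integral => //.
- by move=> x _; rewrite lee_fin clamp_ge0.
- by apply/measurable_EFinP; exact: measurable_clamp.
- by move=> x _; rewrite lee_fin clamp_le1.
Qed.

Lemma meanE (P : probability R R) : (\int[P]_x (clamp x)%:E = (mean P)%:E)%E.
Proof.
have /andP[a0 a1] := integral_clamp_ge0_le1 P.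
by rewrite /mean fineK// ge0_fin_numE// (le_lt_trans a1)// ltry.
Qed.

Lemma mean_ge0_le1 (P : probability R R) : 0 <= mean P <= 1.
Proof. by have := integral_clamp_ge0_le1 P; rewrite meanE !lee_fin. Qed.

Lemma mean_compl (P : probability R R) : (\int[P]_x (1 - clamp x)%:E = (1 - mean P)%:E)%E.
Proof.
have I1 : P.-integrable setT (EFin \o cst (1 : R)).
  exact: (finite_measure_integrable_cst P 1).
have mc := @measurable_clamp R.
have Ic : P.-integrable setT (EFin \o @clamp R).
  apply: le_integrable I1 => //; first exact/measurable_EFinP.
  by move=> x _ /=; rewrite lee_fin normr1 ger0_norm ?clamp_ge0 ?clamp_le1.
rewrite EFinB -meanE; have := integralB_EFin measurableT I1 Ic.
move=> /= ->; congr (_ - _)%E; rewrite (integral_cst P measurableT 1) mul1e.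
exact: (probability_setT P).
Qed.

Lemma measurable_prefix_le m n : (m <= n)%N ->
  measurable_fun (T := Prefix R n) (U := Prefix R m) setT id.
Proof.
move=> mn.
apply: (@measurability _ _ (Prefix R n) (Prefix R m) _ _ (@rectangle R m)) => //=.
move=> _ [_ [A mA ->] <-]; rewrite setTI; apply: sub_sigma_algebra.
exists (fun i => if (i < m)%N then A i else setT); first by move=> i; case: ifP.
apply/seteqP; split => p /= h i; first by move=> _; case: ifP => // /h.
by move=> im; have := h i (leq_trans im mn); rewrite im.
Qed.

Let ctail (p : nat -> R) n j := tail (fun i => clamp (p i)) n j.

Let ctail_ge0 p n j : 0 <= ctail p n j.
Proof. by have /andP[] := clamp_tail_bounds p n j. Qed.

Let ctail_le1 p n j : ctail p n j <= 1.
Proof. by have /andP[] := clamp_tail_bounds p n j. Qed.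

Let measurable_ctail n j : measurable_fun setT (fun p : Prefix R n => ctail p n j).
Proof.
apply: (@measurable_tail R _ (Prefix R n) (fun i p => clamp (p i))) => i ni.
apply: (measurableT_comp (@measurable_clamp R)).
exact: measurable_prefix_coord.
Qed.

Let measurable_prefix_Seq n (f : Prefix R n -> \bar R) : measurable_fun setT f ->
  measurable_fun setT (f : Seq R -> \bar R).
Proof. by move=> mf; exact: (measurableT_comp mf (@measurable_prefix R n)). Qed.

(** In the worst case the first [m] coins, on which [B] depends, all show heads; then [j - m] heads
    must come from the next [l]. Their biases are independent of [B] and enter the tail affinely one
    at a time, so integration replaces each by its mean. *)
Lemma integral_tail_le m (B : set (Prefix R m)) l j : measurable B ->
  (\int[mu]_p (\1_B p * ctail p (m + l) j)%:E <=
   mu B * (tail (fun i => mean (nu (m + i)%N)) l (j - m))%:E)%E.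
Proof.
move=> mB.
have mBS : measurable (B : set (Seq R)).
  by have := @measurable_prefix R m measurableT B mB; rewrite setTI.
have muB : (\int[mu]_p (\1_B p)%:E = mu B)%E.
  by rewrite integral_indic// setIT.
have mG n k : measurable_fun setT
    (fun p : Prefix R (m + n) => (\1_B p * ctail p (m + n) k)%:E).
  apply/measurable_EFinP; apply: measurable_funM => //.
  have mI : measurable_fun setT (\1_B : Prefix R m -> R) by exact: measurable_indic.
  exact: (measurableT_comp mI (measurable_prefix_le (leq_addr n m))).
have G0 n k (p : nat -> R) : (0 <= (\1_B p * ctail p n k)%:E)%E.
  by rewrite lee_fin mulr_ge0.
have bound n k : (\int[mu]_p (\1_B p * ctail p (m + n) k)%:E <= mu B)%E.
  rewrite -muB; apply: ge0_le_integral => //.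
  - exact: (measurable_prefix_Seq (mG n k)).
  - apply/measurable_EFinP; exact: measurable_indic.
  - by move=> p _; rewrite lee_fin ler_piMr.
elim: l j => [|l IH] j.
  have [jm|mj] := leqP j m.
    by move: jm; rewrite -subn_eq0 => /eqP ->; rewrite tail0 mule1.
  rewrite integral0_eq; last by move=> p _; rewrite /ctail addn0 tail_gt// mulr0.
  by rewrite mule_ge0// lee_fin; have := mj; rewrite -subn_gt0; case: (j - m)%N.
case: j => [|j]; first by rewrite sub0n tail0 mule1.
pose n := (m + l)%N; pose q := mean (nu n).
(* Conditions on the last coin, whose bias is independent of the [n] preceding ones. *)
have split_int : (\int[mu]_p (\1_B p * ctail p (m + l.+1) j.+1)%:E =
   \int[mu]_p (\1_B p * ctail p n j)%:E * q%:E +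
   \int[mu]_p (\1_B p * ctail p n j.+1)%:E * (1 - q)%:E)%E.
  have mc := @measurable_clamp R.
  have gc0 (x : R) : (0 <= (clamp x)%:E)%E by rewrite lee_fin clamp_ge0.
  have gc1 (x : R) : (0 <= (1 - clamp x)%:E)%E by rewrite lee_fin subr_ge0 clamp_le1.
  have mc0 : measurable_fun setT (fun x : R => (clamp x)%:E) by exact/measurable_EFinP.
  have mc1 : measurable_fun setT (fun x : R => (1 - clamp x)%:E).
    by apply/measurable_EFinP; exact: measurable_funB.
  rewrite -mean_compl -meanE.
  rewrite -(integral_prefix_coord munu (mG l j) mc0 (G0 _ _) gc0).
  rewrite -(integral_prefix_coord munu (mG l j.+1) mc1 (G0 _ _) gc1).
  rewrite -ge0_integralD//.
  - apply: eq_integral => p _; rewrite /ctail addnS tailS -!EFinM -EFinD; congr EFin.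
    by rewrite -/n; ring.
  - by move=> p _; rewrite mule_ge0.
  - apply: emeasurable_funM; first exact: (measurable_prefix_Seq (mG l j)).
    exact: (measurableT_comp mc0 (@measurable_coord R n)).
  - by move=> p _; rewrite mule_ge0.
  - apply: emeasurable_funM; first exact: (measurable_prefix_Seq (mG l j.+1)).
    exact: (measurableT_comp mc1 (@measurable_coord R n)).
have /andP[q0 q1] : 0 <= q <= 1 by exact: mean_ge0_le1.
rewrite split_int.
(* For [j < m] the truncated difference [j.+1 - m] is 0 and the claimed bound is just [mu B], split
   here with weights [q] and [1 - q]. *)
have [mj|jm] := leqP m j; last first.
  have -> : (j.+1 - m = 0)%N by lia.
  rewrite tail0 mule1 -[leRHS]mule1 (_ : 1%E = q%:E + (1 - q)%:E)%E; last first.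
    by rewrite -EFinD addrC subrK.
  rewrite ge0_muleDr ?lee_fin ?subr_ge0//.
  by apply: leeD; apply: lee_wpmul2r; rewrite ?lee_fin ?subr_ge0//; exact: bound.
rewrite subSn// tailS -/n -/q [X in (_ <= _ * X)%E]EFinD.
have t0 k : 0 <= tail (fun i => mean (nu (m + i)%N)) l k.
  by have /andP[] := @tail_ge0_le1 R (fun i => mean (nu (m + i)%N)) l k
    (fun i => mean_ge0_le1 _).
rewrite ge0_muleDr ?lee_fin ?mulr_ge0 ?subr_ge0//.
apply: leeD; rewrite EFinM [X in (_ <= _ * X)%E]muleC muleA;
  apply: lee_wpmul2r; rewrite ?lee_fin ?subr_ge0//.
by have := IH j.+1; rewrite subSn.
Qed.
End annealed.

(** * Summable deviations of the mean biases and their effect on tails *)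

Lemma onI_integral_clamp (R : realType) (P : probability R R) : onI P ->
  (\int[P]_x (clamp x)%:E = \int[P]_x x%:E)%E.
Proof.
move=> PI; apply: ae_eq_integral => //.
- by apply/measurable_EFinP; exact: measurable_clamp.
pose I := [set x : R | 0 <= x <= 1].
have mI : measurable I.
  by rewrite (_ : I = `[0, 1]%classic).
exists (~` I); split; first exact: measurableC.
  by apply: eq_trans (probability_setC P mI) _; rewrite (PI : P I = 1%E) subee.
by move=> x /=; apply: contra_not => xI _; rewrite clamp_id.
Qed.

(** The squares are at most [8 * C * d (nu n) nu0], hence summable, and the remainder of their
    series from [m] on bounds every block starting at [m]. *)
Lemma centered_mean_summable (R : realType) (nu : nat -> probability R R) (e : R) :
  (forall n, onI (nu n)) -> centered nu -> 0 < e ->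
  exists m0, forall m l, (m0 <= m)%N ->
    \sum_(i < l) (2 * mean (nu (m + i)%N) - 1) ^+ 2 <= e.
Proof.
move=> nuI [nu0 [nu0I nudom mean0 [d [[ddist [C [C0 dC]]] dsum]]]] e0.
pose u n : \bar R := ((2 * mean (nu n) - 1) ^+ 2)%:E.
have d0 n : (0 <= d (nu n) nu0)%E.
  case: ddist => [/(_ _ _ (nuI n) nu0I)[]//|[/(_ _ _ (nuI n) nu0I)[]//]].
have u0 n : (0 <= u n)%E by rewrite lee_fin sqr_ge0.
have ud n : (u n <= (8 * C)%:E * d (nu n) nu0)%E.
  have [|h hell le_h] := mean_sqr_le_hellinger (nudom n) _ (meanE (nu n)).
    by rewrite onI_integral_clamp.
  apply: (@le_trans _ _ (8%:E * (1 - h%:E))%E).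
    by rewrite -EFinB -EFinM lee_fin.
  by rewrite EFinM -muleA lee_pmul2l// dC.
have usum : (\sum_(0 <= n <oo) u n < +oo)%E.
  apply: (@le_lt_trans _ _ (\sum_(0 <= n <oo) ((8 * C)%:E * d (nu n) nu0)))%E.
    by apply: lee_nneseries.
  rewrite nneseriesZl// lte_mul_pinfty// lee_fin mulr_ge0// ltW//.
have /fine_cvgP[] := nneseries_tail_cvg usum (fun n _ => u0 n).
move=> [n1 _ fin1] /cvgrPdist_le /(_ e e0) [n2 _ small].
exists (maxn n1 n2) => m l; rewrite geq_max => /andP[n1m n2m].
have := small m n2m; rewrite /= sub0r normrN => small_m.
have := fin1 m n1m => /= fin_m.
rewrite -lee_fin; apply: (@le_trans _ _ (\sum_(m <= k <oo) u k)%E); last first.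
  by rewrite -(fineK fin_m) lee_fin (le_trans (ler_norm _)).
apply: (@le_trans _ _ (\sum_(m <= k < m + l) u k)%E); last first.
  exact: nneseries_lim_ge.
rewrite -sumEFin -[X in index_iota X _]add0n big_addn addKn big_mkord.
by under [leRHS]eq_bigr do rewrite addnC.
Qed.

(** A sum of at most 1/10 keeps the product in [tail_fair] below 10/9, so the squared tail is at
    most [3/4 * 10/9 = 5/6 < (23/25)^2]. *)
Lemma tail_le_const (R : realType) (q : nat -> R) l j :
  tail (fun=> 2^-1 : R) l j <= 3 / 4 ->
  \sum_(i < l) (2 * q i - 1) ^+ 2 <= 10^-1 ->
  tail q l j <= 23 / 25.
Proof.
move=> fairle sumle; have := tail_fair q l j.
have := @prod_1D_le R (fun i => (2 * q i - 1) ^+ 2) l (fun=> sqr_ge0 _).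
have : 0 <= \prod_(i < l) (1 + (2 * q i - 1) ^+ 2).
  by apply: prodr_ge0 => i _; rewrite addr_ge0// sqr_ge0.
have /andP[v0 v1] := @tail_ge0_le1 R (fun=> 2^-1) l j
  (fun=> ltac:(by apply/andP; split; lra)).
move: (\prod_(i < l) _) (\sum_(i < l) _) (tail q l j)
  (tail (fun=> 2^-1) l j) v0 v1 fairle sumle.
move=> P s t v v0 v1 v34 s10 P0 Ps tv.
have P9 : P <= 10 / 9 by nra.
have vP : v * P <= 3 / 4 * (10 / 9) by apply: ler_pM.
have tt : t ^+ 2 <= 5 / 6 by apply: le_trans tv (le_trans vP _); lra.
by rewrite leNgt; apply/negP => tc; nra.
Qed.

(** * The Condorcet Jury Property has probability zero *)

Section CJP_negligible.
Variable R : realType.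
Variables (nu : nat -> probability R R) (mu : probability (Seq R) R).
Hypotheses (nuI : forall n, onI (nu n)) (munu : is_product_measure mu nu)
  (nuc : centered nu).

Let T (p : nat -> R) k := tail (fun i => clamp (p i)) k.*2.+1 k.+1.

(** The sets [B_M]: for [k < M] only [2 k + 1 < 2 M] votes are involved, so they are events of the
    prefix of length [M.*2]. *)
Let large N M : set (nat -> R) :=
  [set p | forall k, (N <= k < M)%N -> 24 / 25 <= T p k].

Let measurable_large N M : measurable (large N M : set (Prefix R M.*2)).
Proof.
rewrite (_ : large N M = \bigcap_(k in [set k | (N <= k < M)%N])
    [set p | 24 / 25 <= T p k]); last first.
  by apply/seteqP; split => p h k /=; exact: h.
apply: (@bigcap_measurableType _ (Prefix R M.*2)) => k /= /andP[_ kM].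
have mT : measurable_fun setT (fun p : Prefix R M.*2 => T p k).
  apply: (@measurable_tail R _ (Prefix R M.*2) (fun i p => clamp (p i))) => i ik.
  apply: (measurableT_comp (@measurable_clamp R)).
  by apply: measurable_prefix_coord; lia.
have := mT measurableT `[24 / 25, +oo[%classic (measurable_itv _).
rewrite setTI; congr (_ _).
by apply/seteqP; split => p /=; rewrite in_itv/= andbT.
Qed.

Let measurable_large_Seq N M : measurable (large N M : set (Seq R)).
Proof.
by have := @measurable_prefix R M.*2 measurableT _ (@measurable_large N M); rewrite setTI.
Qed.

Lemma large_limit_null N : mu (\bigcap_M (large N M : set (Seq R))) = 0%E.
Proof.
set A := \bigcap_M _.
have mA : measurable A by apply: bigcapT_measurable.
have [m0 m0P] := centered_mean_summable nuI nuc (ltac:(lra) : (0 < 10^-1 :> R)).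
have step M : (m0 <= M)%N -> ((24 / 25)%:E * mu A <= (23 / 25)%:E * mu (large N M))%E.
  move=> m0M; pose m := M.*2.
  have [k0 k0P] := fair_le_near R m.
  (* [k0] yields the fair-coin bound, [N] makes the defining condition of [A] apply at [k], and [m]
     leaves room for the first [m] votes. *)
  pose k := maxn (maxn k0 N) m.
  have kk : [/\ k0 <= k, N <= k & m <= k]%N.
    by rewrite /k !leq_max !leqnn ?orbT.
  case: kk => k0k Nk mk.
  (* This integral is bounded below by restricting to [A], where [T p k] is at least 24/25, and
     above by [integral_tail_le]. *)
  apply: (@le_trans _ _ (\int[mu]_p (\1_(large N M) p * T p k)%:E)%E).
    have T0 p : 0 <= T p k.
      by have /andP[] := clamp_tail_bounds p k.*2.+1 k.+1.
    have mIA : measurable_fun setT (fun p : Seq R => (\1_A p : R)%:E).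
      by apply/measurable_EFinP; exact: measurable_indic.
    have IA : (\int[mu]_p (\1_A p)%:E = mu A)%E by rewrite integral_indic// setIT.
    have c0 : 0 <= 24 / 25 :> R by rewrite divr_ge0.
    rewrite -IA -ge0_integralZl//.
    apply: ge0_le_integral => //.
    - exact: measurable_funeM.
    - apply/measurable_EFinP; apply: measurable_funM.
        by apply: measurable_indic; exact: measurable_large_Seq.
      apply: (@measurable_tail R _ (Seq R) (fun i p => clamp (p i))) => i ik.
      exact: (measurableT_comp (@measurable_clamp R) (@measurable_coord R i)).
    move=> p _; rewrite -EFinM lee_fin !indicE.
    have [pA|] := boolP (p \in A); last by rewrite mulr0 mulr_ge0.
    rewrite inE in pA; rewrite mulr1 mem_set ?mul1r; last exact: pA.
    by apply: (pA k.+1) => //; rewrite Nk ltnSn.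
  have := integral_tail_le munu (k.*2.+1 - m) k.+1 (@measurable_large N M).
  rewrite subnKC; last by lia.
  move=> /le_trans; apply; rewrite muleC; apply: lee_wpmul2r => //.
  rewrite lee_fin; apply: tail_le_const; first exact: k0P.
  apply: m0P; lia.
have cvgA : mu (large N M) @[M --> \oo] --> mu A.
  apply: nonincreasing_cvg_mu => //.
  - by rewrite ltey_eq fin_num_measure.
  - move=> M M' MM'; apply/subsetPset => p h k /andP[Nk kM]; apply: h.
    by rewrite Nk (leq_trans kM).
have Afin : mu A \is a fin_num by rewrite fin_num_measure.
have : ((24 / 23)%:E * mu A <= mu A)%E.
  apply: cvge_ge cvgA; exists m0 => // M /= /step.
  have Mfin : mu (large N M) \is a fin_num.
    by rewrite fin_num_measure//; exact: (@measurable_large_Seq N M).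
  rewrite -(fineK Afin) -(fineK Mfin) -!EFinM !lee_fin; lra.
have : (0 <= mu A)%E by [].
by rewrite -(fineK Afin) -EFinM !lee_fin => A0 Ale; congr EFin; lra.
Qed.

(** Convergence to 1 with tolerance 1/25 puts each sequence of [C_I] into the limit set of some [N],
    and these countably many sets are null. *)
Lemma C_I_negligible : mu.-negligible (C_I R : set (Seq R)).
Proof.
apply: (@negligibleS _ _ _ _ (\bigcup_N \bigcap_M (large N M : set (Seq R)))); last first.
  apply: negligible_bigcup => N; exists (\bigcap_M (large N M : set (Seq R))).
  split=> //; [exact: bigcapT_measurable|exact: large_limit_null].
move=> p [p01 /cvgrPdist_le/(_ 25^-1 ltac:(lra))[N _ pN]].
exists N => // M _ k /andP[Nk _]; have := pN k Nk.
rewrite /= majority_probE /T.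
rewrite (@eq_tail R (fun i => clamp (p i)) p) => [|i _]; last by rewrite clamp_id.
by move=> /(le_trans (ler_norm _)); lra.
Qed.
End CJP_negligible.

Theorem theorem1 (R : realType) (nu : nat -> probability R R)
  (mu : probability (Seq R) R) :
  (forall n, onI (nu n)) ->
  is_product_measure mu nu ->
  centered nu ->
  mu.-negligible (C_I R : set (Seq R)).
Proof. exact: C_I_negligible. Qed.
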